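(* Let $K\subset S^3$ be a knot and, for each prime $p<\infty$, let $h(t_p)$ be the entropy of the meridian action $t_p$ on the $p$-adic Alexander module $H_1(X_\infty(K);\mathbb{Q}_p)$. If the Alexander module $H_1(X_\infty(K);\mathbb{Z})$ is finitely generated as a $\mathbb{Z}$-module, then $h(t_p)=0$ for all finite primes $p<\infty$.
   Context: $X_\infty(K)$ is the infinite cyclic cover of $S^3\setminus K$. The Alexander module $H_1(X_\infty(K);\mathbb{Z})$ is a $\mathbb{Z}[t^{\pm1}]$-module, where $t$ acts as the meridian action, i.e. the map induced by the generator of the deck transformation group corresponding to a meridian of $K$; $t_p$ denotes the induced $\mathbb{Q}_p$-linear automorphism of the finite-dimensional $\mathbb{Q}_p$-vector space $H_1(X_\infty(K);\mathbb{Q}_p)$. Entropy: for a surjective continuous endomorphism $T$ of a locally compact abelian group with translation-invariant metric $d$ inducing the topology and Haar measure $\mu$, $$h(T)=h_d(T)=\lim_{\varepsilon\to0}\limsup_{m\to\infty}\Big[-\frac1m\log\mu\Big(\bigcap_{k=0}^{m-1}T^{-k}B(e,\varepsilon)\Big)\Big],$$ where $B(e,\varepsilon)$ is the open $\varepsilon$-ball around the identity. On a finite-dimensional $\mathbb{Q}_p$-vector space, $d$ is the metric of a norm. *)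

(* Defs.v *)
From HB Require Import structures.
From mathcomp Require Import all_boot all_order all_algebra generic_quotient ring_quotient.
From mathcomp Require Import all_classical all_reals all_analysis.
From mathcomp Require Import freeg zify ring lra.
Set Implicit Arguments. Unset Strict Implicit. Unset Printing Implicit Defensive.
Import Order.TTheory GRing.Theory Num.Theory.
Import numFieldNormedType.Exports.
Local Open Scope classical_set_scope.
Local Open Scope ring_scope.
Local Open Scope quotient_scope.
Section PadicAbs.
Variables (p : nat) (hp : prime p).

(* For x = 0 this is a junk value; [padic_abs] treats 0 separately. *)
Definition padic_val (x : rat) : int :=
  (logn p `|numq x|%N)%:Z - (logn p `|denq x|%N)%:Z.

Definition padic_abs (x : rat) : rat :=
  if x == 0 then 0 else p%:R ^ (- padic_val x).

Lemma padic_val_frac (a b : int) : a != 0 -> b != 0 ->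
  padic_val (a%:Q / b%:Q) = (logn p `|a|%N)%:Z - (logn p `|b|%N)%:Z.
Proof.
move=> a0 b0; set x := _ / _; rewrite /padic_val.
have x0 : x != 0 by rewrite mulf_neq0 ?invr_eq0 ?intr_eq0.
have E : numq x * b = a * denq x.
  apply: (@intr_inj rat); rewrite !intrM.
  apply/eqP; rewrite -eqr_div ?intr_eq0 ?denq_neq0// divq_num_den.
  exact/eqP.
have /(congr1 (fun n => logn p n)) : (`|numq x| * `|b| = `|a| * `|denq x|)%N.
  by rewrite -!abszM E.
rewrite !lognM ?absz_gt0 ?numq_eq0 ?denq_neq0// => /(congr1 Posz).
by rewrite !PoszD; lia.
Qed.

Lemma padic_abs0 : padic_abs 0 = 0. Proof. by rewrite /padic_abs eqxx. Qed.

Let p0 : (p%:R : rat) != 0.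
Proof. by rewrite pnatr_eq0 -lt0n prime_gt0. Qed.

Lemma padic_abs_eq0 x : (padic_abs x == 0) = (x == 0).
Proof.
rewrite /padic_abs; case: (eqVneq x 0) => [_|x0]; first by rewrite eqxx.
by rewrite expfz_eq0 (negbTE p0) andbF.
Qed.

Lemma padic_abs_ge0 x : 0 <= padic_abs x.
Proof. by rewrite /padic_abs; case: ifP => // _; rewrite exprz_ge0. Qed.

Lemma padic_abs1 : padic_abs 1 = 1.
Proof. by rewrite /padic_abs oner_eq0 /padic_val (_ : numq 1 = 1)// (_ : denq 1 = 1)// subrr oppr0. Qed.

Lemma padic_absM x y : padic_abs (x * y) = padic_abs x * padic_abs y.
Proof.
rewrite /padic_abs mulf_eq0.
case: (eqVneq x 0) => [|x0] /=; first by rewrite mul0r.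
case: (eqVneq y 0) => [|y0] /=; first by rewrite mulr0.
rewrite -expfzDr//; congr (_ ^ _); rewrite -opprD; congr (- _).
rewrite -[in LHS](divq_num_den x) -[in LHS](divq_num_den y) mulf_div -!intrM.
rewrite padic_val_frac ?mulf_neq0 ?numq_eq0 ?denq_neq0// /padic_val.
by rewrite !abszM !lognM ?absz_gt0 ?numq_eq0 ?denq_neq0//; lia.
Qed.

Lemma padic_absN x : padic_abs (- x) = padic_abs x.
Proof.
by rewrite /padic_abs oppr_eq0; case: ifP => // _; rewrite /padic_val numqN denqN abszN.
Qed.

Lemma padic_absV x : padic_abs x^-1 = (padic_abs x)^-1.
Proof.
have [->|x0] := eqVneq x 0; first by rewrite invr0 padic_abs0 ?invr0.
apply: (@mulIf _ (padic_abs x)); first by rewrite padic_abs_eq0.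
by rewrite -padic_absM mulVf// padic_abs1 mulVf// padic_abs_eq0.
Qed.

Lemma padic_absD x y :
  padic_abs (x + y) <= Num.max (padic_abs x) (padic_abs y).
Proof.
have [->|x0] := eqVneq x 0; first by rewrite add0r le_max lexx orbT.
have [->|y0] := eqVneq y 0; first by rewrite addr0 le_max lexx.
have [->|s0] := eqVneq (x + y) 0; first by rewrite padic_abs0 le_max padic_abs_ge0.
pose a : int := numq x * denq y; pose c : int := numq y * denq x; pose b : int := denq x * denq y.
have b0 : b != 0 by rewrite mulf_neq0 ?denq_neq0.
have a0 : a != 0 by rewrite mulf_neq0 ?numq_eq0 ?denq_neq0.
have c0 : c != 0 by rewrite mulf_neq0 ?numq_eq0 ?denq_neq0.
have dq z : (denq z)%:~R != 0 :> rat by rewrite intr_eq0 denq_neq0.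
have xE : x = a%:Q / b%:Q.
  by rewrite /a /b !intrM -mulf_div divff// mulr1 divq_num_den.
have yE : y = c%:Q / b%:Q.
  by rewrite /c /b !intrM [in X in _ / X]mulrC -mulf_div divff// mulr1 divq_num_den.
have sE : x + y = (a + c)%:Q / b%:Q by rewrite xE yE intrD mulrDl.
have ac0 : a + c != 0.
  by apply: contraNneq s0 => ac; rewrite sE ac mul0r.
rewrite {1}/padic_abs (negbTE s0) {1}/padic_abs (negbTE x0) /padic_abs (negbTE y0).
rewrite sE xE yE !padic_val_frac//.
have p1 : 1 < (p%:R : rat) by rewrite ltr1n prime_gt1.
rewrite le_max !ler_eXz2l// !lerN2 !lerD2r !lez_nat.
set m := minn (logn p `|a|%N) (logn p `|c|%N).
have : (p ^ m %| `|(a + c)%R|)%N.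
  have da : (p ^ m %| `|a|)%N.
    by rewrite pfactor_dvdn ?absz_gt0// geq_minl.
  have dc : (p ^ m %| `|c|)%N.
    by rewrite pfactor_dvdn ?absz_gt0// geq_minr.
  have: ((p ^ m)%:Z %| a + c)%Z by apply: rpredD; rewrite dvdzE.
  by rewrite dvdzE.
by rewrite pfactor_dvdn ?absz_gt0// /m geq_min.
Qed.

Lemma padic_absB x y : padic_abs (x - y) <= Num.max (padic_abs x) (padic_abs y).
Proof. by rewrite -(padic_absN y) padic_absD. Qed.

Lemma padic_abs_sym x y : padic_abs (x - y) = padic_abs (y - x).
Proof. by rewrite -padic_absN opprB. Qed.

End PadicAbs.

Section Padic.
Variables (p : nat) (hp : prime p).
Local Notation "`| x |p" := (padic_abs p x) (at level 0, x at level 99).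

(* The primality proof is an argument so that the closure properties below, which
   need it, can be declared as canonical instances. *)
Definition cauchy_seq of prime p : {pred nat -> rat} := fun u =>
  `[< forall e : rat, 0 < e ->
      \forall m & n \near \oo, `| u m - u n |p < e >].

Definition null_seq (u : nat -> rat) :=
  forall e : rat, 0 < e -> \forall n \near \oo, `| u n |p < e.

Lemma cauchy_seqP u : reflect
  (forall e : rat, 0 < e -> exists N, forall m n,
     (N <= m)%N -> (N <= n)%N -> `| u m - u n |p < e)
  (u \in cauchy_seq hp).
Proof.
apply: (iffP (asboolP _)) => H e /H.
  by move=> [[A B] /= [[N _ hN] [M _ hM]] AB]; exists (maxn N M) => m n;
    rewrite !geq_max => /andP[? ?] /andP[? ?]; apply: (AB (m, n)); split; [exact: hN|exact: hM].
by move=> [N hN]; exists ([set n | (N <= n)%N], [set n | (N <= n)%N]);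
  [split; exists N|case=> m n [/= ? ?]; exact: hN].
Qed.

Lemma cauchy_bounded u : u \in cauchy_seq hp ->
  exists c : rat, 0 < c /\ exists N, forall n, (N <= n)%N -> `| u n |p <= c.
Proof.
move=> /cauchy_seqP /(_ 1 ltr01) [N hN].
exists (Num.max 1 `| u N |p); split; first by rewrite lt_max ltr01.
exists N => n Nn; rewrite -(subrK (u N) (u n)) (le_trans (padic_absD hp _ _))//.
by rewrite ge_max !le_max lexx orbT andbT ltW// hN.
Qed.

Lemma cauchy_subring : subring_closed (cauchy_seq hp).
Proof.
split.
- by apply/cauchy_seqP => e e0; exists 0%N => m n _ _; rewrite subrr padic_abs0.
- move=> u v /cauchy_seqP hu /cauchy_seqP hv; apply/cauchy_seqP => e e0.
  have [N hN] := hu e e0; have [M hM] := hv e e0.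
  exists (maxn N M) => m n; rewrite !geq_max => /andP[? ?] /andP[? ?].
  rewrite [X in `| X |p](_ : _ = (u m - u n) - (v m - v n)); last first.
    change ((u m - v m) - (u n - v n) = (u m - u n) - (v m - v n) :> rat); ring.
  by rewrite (le_lt_trans (padic_absB hp _ _))// gt_max hN// hM.
- move=> u v cu cv; have [c [c0 [N1 hc]]] := cauchy_bounded cu.
  have [d [d0 [N2 hd]]] := cauchy_bounded cv.
  move: cu cv => /cauchy_seqP hu /cauchy_seqP hv; apply/cauchy_seqP => e e0.
  have [N hN] := hu (e / d) (divr_gt0 e0 d0).
  have [M hM] := hv (e / c) (divr_gt0 e0 c0).
  exists (maxn (maxn N1 N2) (maxn N M)) => m n.
  rewrite !geq_max => /andP[/andP[? ?] /andP[? ?]] /andP[/andP[? ?] /andP[? ?]].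
  rewrite [X in `| X |p](_ : _ = u m * (v m - v n) + (u m - u n) * v n); last first.
    change ((u m * v m) - (u n * v n) = u m * (v m - v n) + (u m - u n) * v n :> rat); ring.
  rewrite (le_lt_trans (padic_absD hp _ _))// gt_max !padic_absM//.
  apply/andP; split.
    apply: (@le_lt_trans _ _ (c * `| v m - v n |p)).
      by rewrite ler_wpM2r ?padic_abs_ge0// hc.
    by rewrite mulrC -ltr_pdivlMr// hM.
  apply: (@le_lt_trans _ _ (`| u m - u n |p * d)).
    by rewrite ler_wpM2l ?padic_abs_ge0// hd.
  by rewrite -ltr_pdivlMr// hN.
Qed.

HB.instance Definition _ :=
  GRing.isSubringClosed.Build (nat -> rat) (cauchy_seq hp) cauchy_subring.

Definition padic_cauchy := {u | u \in cauchy_seq hp}.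
HB.instance Definition _ := SubChoice.on padic_cauchy.
HB.instance Definition _ := [SubChoice_isSubComNzRing of padic_cauchy by <:].

Definition null_cauchy : {pred padic_cauchy} := fun u => `[< null_seq (val u) >].

Lemma null_cauchyP (u : padic_cauchy) : reflect
  (forall e : rat, 0 < e -> exists N, forall n, (N <= n)%N -> `| val u n |p < e)
  (u \in null_cauchy).
Proof.
apply: (iffP (asboolP _)) => H e /H.
  by move=> [N _ hN]; exists N => n; exact: hN.
by move=> [N hN]; exists N => // n; exact: hN.
Qed.

Lemma null_idealr : idealr_closed null_cauchy.
Proof.
split.
- by apply/null_cauchyP => e e0; exists 0%N => n _; rewrite padic_abs0.
- apply/negP => /null_cauchyP /(_ 1 ltr01) [N /(_ N (leqnn _))].
  by rewrite padic_abs1 ltxx.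
- move=> a u v /null_cauchyP hu /null_cauchyP hv; apply/null_cauchyP => e e0.
  have [c [c0 [N1 hc]]] := cauchy_bounded (valP a).
  have [N hN] := hu (e / c) (divr_gt0 e0 c0); have [M hM] := hv e e0.
  exists (maxn N1 (maxn N M)) => n; rewrite !geq_max => /and3P[? ? ?].
  rewrite rmorphD rmorphM /= [X in `| X |p]/(val a n * val u n + val v n).
  rewrite (le_lt_trans (padic_absD hp _ _))// gt_max hM// andbT padic_absM//.
  apply: (@le_lt_trans _ _ (c * `| val u n |p)).
    by rewrite ler_wpM2r ?padic_abs_ge0// hc.
  by rewrite mulrC -ltr_pdivlMr// hN.
Qed.

HB.instance Definition _ := isIdealr.Build padic_cauchy null_cauchy null_idealr.

(* Q_p, as the completion of Q for the p-adic absolute value: the ring of Cauchy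
   sequences of rationals modulo the ideal of null sequences. *)
Definition padic := {ideal_quot null_cauchy}.
HB.instance Definition _ := GRing.ComNzRing.on padic.

Lemma not_null_cauchy (u : padic_cauchy) : u \notin null_cauchy ->
  exists c : rat, 0 < c /\ exists N, forall n, (N <= n)%N -> c <= `| val u n |p.
Proof.
move=> /negP nu; apply: contrapT => h; apply: nu; apply/null_cauchyP => e e0.
have /cauchy_seqP /(_ e e0) [N hN] := valP u.
have : exists n, (N <= n)%N /\ `| val u n |p < e.
  apply: contrapT => h2; apply: h; exists e; split => //; exists N => n Nn.
  by rewrite leNgt; apply/negP => hn; apply: h2; exists n.
move=> [k [Nk hk]]; exists N => n Nn.
rewrite -(subrK (val u k) (val u n)) (le_lt_trans (padic_absD hp _ _))//.
by rewrite gt_max hk hN.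
Qed.

Lemma padic_has_inv (x : padic) : exists y : padic, x != 0 -> y * x = 1.
Proof.
have [->|x0] := eqVneq x 0; first by exists 0.
have : repr x \notin null_cauchy.
  apply: contra x0 => hx; have : repr x == 0 %[mod padic].
    by rewrite -Quotient.idealrBE subr0.
  by rewrite reprK => /eqP ->; rewrite piE Quotient.equivE subrr rpred0.
move=> /not_null_cauchy [c [c0 [N hc]]].
have cv : (fun n => (val (repr x) n)^-1) \in cauchy_seq hp.
  apply/cauchy_seqP => e e0.
  have /cauchy_seqP /(_ (e * c ^+ 2)) [|M hM] := valP (repr x).
    by rewrite mulr_gt0// exprn_gt0.
  exists (maxn N M) => m n; rewrite !geq_max => /andP[Nm Mm] /andP[Nn Mn].
  set a := val _ m; set b := val _ n.
  have ca : c <= `| a |p by exact: hc.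
  have cb : c <= `| b |p by exact: hc.
  have a0 : a != 0 by rewrite -(padic_abs_eq0 hp) gt_eqF // (lt_le_trans c0 ca).
  have b0 : b != 0 by rewrite -(padic_abs_eq0 hp) gt_eqF // (lt_le_trans c0 cb).
  rewrite (_ : a^-1 - b^-1 = (b - a) / (a * b)); last by field; rewrite ?a0 ?b0.
  rewrite padic_absM// padic_absV// ltr_pdivrMr; last first.
    by rewrite lt_neqAle padic_abs_ge0// eq_sym padic_abs_eq0// mulf_neq0.
  apply: (@lt_le_trans _ _ (e * c ^+ 2)); first exact: hM.
  rewrite ler_pM2l// padic_absM// expr2.
  by apply: ler_pM => //; exact: ltW.
exists (\pi_padic (Sub (fun n => (val (repr x) n)^-1) cv : padic_cauchy)) => _.
apply/eqP; rewrite -[X in _ * X]reprK !piE Quotient.equivE.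
apply/null_cauchyP => e e0; exists N => n Nn.
rewrite rmorphB rmorphM rmorph1 /= [X in `| X |p]/((val (repr x) n)^-1 * (val (repr x) n) - 1).
rewrite mulVf ?subrr ?padic_abs0//.
by rewrite -(padic_abs_eq0 hp) gt_eqF// (lt_le_trans c0)// hc.
Qed.

Definition padic_inv (x : padic) : padic :=
  if x == 0 then 0 else projT1 (cid (padic_has_inv x)).

Lemma padic_mulVf (x : padic) : x != 0 -> padic_inv x * x = 1.
Proof.
by rewrite /padic_inv; case: cid => y /= h x0; rewrite (negbTE x0); exact: h.
Qed.

Lemma padic_inv0 : padic_inv 0 = 0. Proof. by rewrite /padic_inv; case: cid => y _ /=; rewrite eqxx. Qed.

HB.instance Definition _ :=
  GRing.ComNzRing_isField.Build padic padic_mulVf padic_inv0.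

(* The p-adic absolute value extended to Q_p by continuity; the limit exists for any
   Cauchy sequence and does not depend on the representative. *)
Definition padic_norm (R : realType) (x : padic) : R :=
  limn (fun n => ratr `| val (repr x) n |p : R).

Lemma padic_normN1 (R : realType) : padic_norm R (- 1) = 1.
Proof.
rewrite /padic_norm; set r := repr _; apply: lim_near_cst => //.
have : r == - 1 %[mod padic] by rewrite /r reprK !piE Quotient.equivE subrr rpred0.
rewrite -Quotient.idealrBE opprK => /null_cauchyP /(_ 1 ltr01) [N hN].
exists N => // n /= /hN; rewrite rmorphD rmorph1 /=.
rewrite [X in `| X |p]/(val r n + 1) => h.
rewrite (_ : `| val r n |p = 1) ?rmorph1//; apply/eqP; rewrite eq_le; apply/andP; split.
  rewrite -(addrK 1 (val r n)) (le_trans (padic_absB hp _ _))//.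
  by rewrite ge_max ltW//= padic_abs1.
have := padic_absB hp (val r n + 1) (val r n).
by rewrite addrAC subrr add0r padic_abs1 le_max leNgt h.
Qed.

Lemma padic_norm0 (R : realType) : padic_norm R 0 = 0.
Proof.
rewrite /padic_norm; set r := repr _; apply/cvg_lim => //.
have : r == 0 %[mod padic] by rewrite /r reprK !piE Quotient.equivE subrr rpred0.
rewrite -Quotient.idealrBE subr0 => /null_cauchyP hr.
apply/cvgr0Pnorm_lt => e e0.
have [n] := ltr_add_invr e0; rewrite add0r => en.
have [|N hN] := hr n.+1%:R^-1; first by rewrite invr_gt0.
exists N => // m /= /hN h; rewrite ger0_norm; last by rewrite ler0q padic_abs_ge0.
by rewrite (lt_trans _ en)// -(ratr_nat R) -fmorphV ltr_rat.
Qed.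

End Padic.
Section FgLift.
Variables (k : nzRingType) (T : choiceType) (V : lmodType k) (f : T -> V).

Lemma fglift_linear : linear (fglift f).
Proof.
have addf := lift_is_additive f.
pose F : {additive {freeg T / k} -> V} :=
  HB.pack (fglift f) (GRing.isZmodMorphism.Build _ _ _ addf).
move=> a u v; rewrite -[fglift f]/(F : _ -> _) raddfD; congr (_ + _).
have -> : a *: u = \sum_(x <- dom u) << a * coeff x u *g x >>.
  by [].
rewrite -[u in RHS]freeg_sumE !raddf_sum /=; apply: eq_bigr => x _.
by rewrite [LHS]liftU [fglift _ _ in RHS]liftU scalerA.
Qed.

HB.instance Definition _ := GRing.isLinear.Build k {freeg T / k} V *:%R (fglift f) fglift_linear.
End FgLift.

Section Simplices.
Variable R : realType.

Definition simplex n : set 'rV[R]_n.+1 :=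
  [set x | (forall i, 0 <= x ord0 i) /\ \sum_i x ord0 i = 1].
Arguments simplex : clear implicits.

(* Inserts a 0 at position i. *)
Definition face_row n (i : 'I_n.+2) (x : 'rV[R]_n.+1) : 'rV[R]_n.+2 :=
  \row_j oapp (x ord0) 0 (unlift i j).

Lemma face_row_simplex n (i : 'I_n.+2) (x : simplex n) :
  face_row i (val x) \in simplex n.+1.
Proof.
have [x0 x1] := set_valP x; apply/mem_set; split=> [j|].
  by rewrite mxE; case: unliftP => //= j' _; exact: x0.
rewrite (bigD1_ord i)//= mxE unlift_none/= add0r -[RHS]x1.
by apply: eq_bigr => j _; rewrite mxE liftK.
Qed.

Definition face_map n (i : 'I_n.+2) (x : simplex n) : simplex n.+1 :=
  SigSub (face_row_simplex i x).

Lemma face_map_continuous n (i : 'I_n.+2) : continuous (@face_map n i).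
Proof.
apply: (@continuous_comp_initial _ _ _ (set_val : simplex n.+1 -> _)).
move=> x; rewrite /= => A [P xP PA].
suff : \forall y \near x, forall ij, P ij.1 ij.2 (face_row i (val y) ij.1 ij.2).
  by apply: filterS => y Py; apply: PA => a b; exact: (Py (a, b)).
apply: (@filter_forall _ ('I_1 * 'I_n.+2)%type
  (fun ij => [set y : simplex n | P ij.1 ij.2 (face_row i (val y) ij.1 ij.2)]) (nbhs x)) => -[a b] /=; have := xP a b.
rewrite mxE; case E: (unlift i b) => [c|] /= h; last first.
  by apply: nearW => y; rewrite /= mxE E; exact: nbhs_singleton h.
have /(_ _ h) : {for x, continuous (fun y : simplex n => (val y : 'rV_n.+1) ord0 c)}.
  apply: (@continuous_comp _ _ _ (set_val : simplex n -> 'rV[R]_n.+1)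
    (fun M => M ord0 c)).
    exact: initial_continuous.
  exact: coord_continuous.
move=> H; change (nbhs x (fun y : simplex n => P a b (face_row i (val y) a b))).
rewrite (_ : (fun y => P a b (face_row i (val y) a b)) =
  (fun y : simplex n => P a b (val y ord0 c)))//.
by apply/funext => y /=; rewrite mxE E.
Qed.

HB.instance Definition _ n (i : 'I_n.+2) :=
  isContinuous.Build _ _ (@face_map n i) (@face_map_continuous n i).
End Simplices.
Arguments simplex : clear implicits.

Section Homology.
Variables (R : realType) (k : nzRingType).
Implicit Types X Y : topologicalType.

(* Singular chains: the free k-module on continuous maps from the n-simplex to X. *)
Definition chain X n := {freeg (continuousType (simplex R n) X) / k}.
HB.instance Definition _ X n := GRing.Lmodule.on (chain X n).

Definition boundary X n : chain X n.+1 -> chain X n :=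
  fglift (fun s : continuousType (simplex R n.+1) X =>
    \sum_(i < n.+2) (-1) ^+ i *:
      << (s \o face_map i : continuousType (simplex R n) X) >>).
HB.instance Definition _ X n := GRing.isLinear.Build k (chain X n.+1) (chain X n)
  *:%R (@boundary X n) (fglift_linear _).

Definition push_chain X Y (f : continuousType X Y) n : chain X n -> chain Y n :=
  fglift (fun s : continuousType (simplex R n) X =>
    << (f \o s : continuousType (simplex R n) Y) >>).
HB.instance Definition _ X Y f n := GRing.isLinear.Build k (chain X n) (chain Y n)
  *:%R (@push_chain X Y f n) (fglift_linear _).

Lemma push_chain_boundary X Y (f : continuousType X Y) n (c : chain X n.+1) :
  boundary (push_chain f c) = push_chain f (boundary c).
Proof.
rewrite -[c]freeg_sumE !raddf_sum /=; apply: eq_bigr => s _.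
rewrite /push_chain /boundary !liftU !linearZ /=; congr (_ *: _).
rewrite liftU scale1r linear_sum; apply: eq_bigr => i _.
rewrite linearZ /= liftU scale1r; congr (_ *: << _ >>).
exact/continuousEP.
Qed.

Definition is_cycle X : {pred chain X 1} := fun c => boundary c == 0.

Lemma is_cycle_submod X : submod_closed (@is_cycle X).
Proof.
split=> [|a u v /eqP hu /eqP hv]; apply/eqP; first exact: raddf0.
by rewrite linearP /= hu hv scaler0 addr0.
Qed.
HB.instance Definition _ X :=
  GRing.isSubmodClosed.Build k (chain X 1) (@is_cycle X) (@is_cycle_submod X).

Definition cycle1 X := {c | c \in @is_cycle X}.
HB.instance Definition _ X := SubChoice.on (cycle1 X).
HB.instance Definition _ X := [SubChoice_isSubLmodule of cycle1 X by <:].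

Definition is_boundary X : {pred cycle1 X} :=
  fun z => `[< exists d : chain X 2, boundary d = val z >].

Lemma is_boundaryP X (z : cycle1 X) :
  reflect (exists d : chain X 2, boundary d = val z) (z \in @is_boundary X).
Proof. exact: asboolP. Qed.

Lemma is_boundary_submod X : submod_closed (@is_boundary X).
Proof.
split=> [|a u v]; first by apply/is_boundaryP; exists 0; rewrite raddf0.
move=> /is_boundaryP[c hc] /is_boundaryP[d hd]; apply/is_boundaryP.
by exists (a *: c + d); rewrite linearP /= hc hd.
Qed.
HB.instance Definition _ X :=
  GRing.isSubmodClosed.Build k (cycle1 X) (@is_boundary X) (@is_boundary_submod X).

Definition H1 X := Quotient.quot (@is_boundary X).
HB.instance Definition _ X := GRing.Zmodule.on (H1 X).
HB.instance Definition _ X := EqQuotient.on (H1 X).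

Definition H1_scale X (a : k) : H1 X -> H1 X := lift_op1 (H1 X) ( *:%R a).

Lemma pi_H1_scale X a (u : cycle1 X) :
  \pi_(H1 X) (a *: u) = H1_scale a (\pi_(H1 X) u).
Proof.
unlock H1_scale; apply/eqP; rewrite -Quotient.idealrBE -scalerBr.
by rewrite rpredZ// Quotient.idealrBE reprK.
Qed.
Canonical pi_H1_scale_morph X a := PiMorph1 (@pi_H1_scale X a).

Lemma H1_scaleA X a b (v : H1 X) : H1_scale a (H1_scale b v) = H1_scale (a * b) v.
Proof. by rewrite -[v]reprK !piE scalerA. Qed.

Lemma H1_scale1 X : left_id 1 (@H1_scale X).
Proof. by move=> v; rewrite -[v]reprK !piE scale1r. Qed.

Lemma H1_scaleDr X : right_distributive (@H1_scale X) +%R.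
Proof. by move=> a u v; rewrite -[u]reprK -[v]reprK !piE scalerDr. Qed.

Lemma H1_scaleDl X (v : H1 X) : {morph (@H1_scale X)^~ v : a b / a + b}.
Proof. by move=> a b; rewrite -[v]reprK !piE scalerDl. Qed.

HB.instance Definition _ X := GRing.Zmodule_isLmodule.Build k (H1 X)
  (@H1_scaleA X) (@H1_scale1 X) (@H1_scaleDr X) (@H1_scaleDl X).

Section Functoriality.
Variables (X Y : topologicalType) (f : continuousType X Y).

Lemma push_cycle_subproof (z : cycle1 X) : push_chain f (val z) \in @is_cycle Y.
Proof.
rewrite unfold_in /is_cycle push_chain_boundary.
by have /eqP -> := valP z; rewrite raddf0.
Qed.

Definition push_cycle (z : cycle1 X) : cycle1 Y := SigSub (push_cycle_subproof z).

(* Independence of the representative is [pi_H1_map] below. *)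
Definition H1_map (h : H1 X) : H1 Y := \pi_(H1 Y) (push_cycle (repr h)).

Lemma pi_H1_map (z : cycle1 X) : H1_map (\pi_(H1 X) z) = \pi_(H1 Y) (push_cycle z).
Proof.
apply/eqP; rewrite /H1_map -Quotient.idealrBE; apply/is_boundaryP.
have /is_boundaryP[d hd] : repr (\pi_(H1 X) z) - z \in @is_boundary X.
  by rewrite Quotient.idealrBE reprK.
exists (push_chain f d); rewrite push_chain_boundary hd.
by rewrite !raddfB.
Qed.

Lemma H1_map_linear : linear H1_map.
Proof.
move=> a u v; rewrite -[u]reprK -[v]reprK.
have piP Z b (x y : cycle1 Z) :
    b *: \pi_(H1 Z) x + \pi_(H1 Z) y = \pi_(H1 Z) (b *: x + y).
  by rewrite -[b *: _]/(H1_scale b _) !piE.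
rewrite piP !pi_H1_map piP; congr (\pi_(H1 Y) _); apply: val_inj => /=.
by rewrite !linearP.
Qed.
HB.instance Definition _ := GRing.isLinear.Build k (H1 X) (H1 Y) *:%R H1_map H1_map_linear.
End Functoriality.
End Homology.

Section Entropy.
Variables (R : realType) (G : metricType R) (e : G).

Definition bowen_ball (T : G -> G) (eps : R) (m : nat) : set G :=
  \bigcap_(k in [set k | (k < m)%N]) (iter k T @^-1` ball e eps).

(* The term at m = 0 is meaningless, but does not affect the limsup. *)
Definition entropy_scale (mu : set G -> \bar R) (T : G -> G) (eps : R) : \bar R :=
  limn_esup (fun m => - (m%:R^-1%:E * lne (mu (bowen_ball T eps m))))%E.

(* "h(T) = h": convergence is part of the predicate, so that the default value that
   [lim] takes on a divergent filter plays no role. *)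
Definition has_entropy (mu : set G -> \bar R) (T : G -> G) (h : \bar R) : Prop :=
  entropy_scale mu T eps @[eps --> 0^'+] --> h.
End Entropy.

Definition borel_type (G : ptopologicalType) := g_sigma_algebraType (@open G).
HB.instance Definition _ (G : ptopologicalType) := Measurable.on (borel_type G).

Section Norm.
Variables (R : realType) (p : nat) (hp : prime p) (V : lmodType (padic hp)).

(* Nonnegativity and N 0 = 0 follow from these axioms. Only the ordinary triangle
   inequality is required, so ultrametric norms are included. *)
Record vnorm := VNorm {
  vnorm_fun :> V -> R;
  vnorm_eq0 : forall v, vnorm_fun v = 0 -> v = 0;
  vnormD : forall u v, vnorm_fun (u + v) <= vnorm_fun u + vnorm_fun v;
  vnormZ : forall a v, vnorm_fun (a *: v) = padic_norm R a * vnorm_fun v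
}.

Definition normed_space (N : vnorm) : Type := V.
HB.instance Definition _ N := GRing.Lmodule.on (normed_space N).

Lemma vnorm0 (N : vnorm) : N 0 = 0.
Proof. by rewrite -(scale0r 0) vnormZ padic_norm0 mul0r. Qed.

Lemma vnormN (N : vnorm) v : N (- v) = N v.
Proof. by rewrite -scaleN1r vnormZ padic_normN1 mul1r. Qed.

Section Metric.
Variable N : vnorm.
Definition vdist (u v : normed_space N) : R := N (u - v).

Lemma vdistxx u : vdist u u = 0.
Proof. by rewrite /vdist subrr vnorm0. Qed.

Lemma vdist_positivity u v : vdist u v = 0 -> u = v.
Proof. by move=> /vnorm_eq0/eqP; rewrite subr_eq0 => /eqP. Qed.

Lemma vdist_sym u v : vdist u v = vdist v u.
Proof. by rewrite /vdist -vnormN opprB. Qed.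

Lemma vdist_triangle v u w : vdist u w <= vdist u v + vdist v w.
Proof. by rewrite /vdist -(subrKA v) vnormD. Qed.

HB.instance Definition _ :=
  isMetric.Build R (normed_space N) vdistxx vdist_positivity vdist_sym vdist_triangle.
HB.instance Definition _ := isPointed.Build (normed_space N) 0.


(* Regularity is automatic on a finite-dimensional Q_p-vector space, which is locally
   compact and second countable. *)
Record haar_measure
    (mu : {measure set (borel_type (normed_space N)) -> \bar R}) : Prop := {
  haar_translation : forall (a : normed_space N)
      (A : set (borel_type (normed_space N))),
    measurable A -> mu [set (x : normed_space N) + a | x in A] = mu A;
  haar_compact : forall A : set (normed_space N), compact A -> (mu A < +oo)%E;
  haar_open : forall A : set (normed_space N), open A -> A !=set0 -> (0 < mu A)%E
}.
End Metric.
End Norm.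

Definition finitely_generated (M : zmodType) : Prop :=
  exists n (g : 'I_n -> M), forall x, exists c : 'I_n -> int,
    x = \sum_(i < n) g i *~ c i.

Section Knot.
Variable R : realType.

Definition sphere n : set 'rV[R]_n.+1 := [set x | \sum_i x ord0 i ^+ 2 = 1].
Definition disk n : set 'rV[R]_n := [set x | \sum_i x ord0 i ^+ 2 <= 1].
Arguments sphere : clear implicits.
Arguments disk : clear implicits.

(* phi restricts to a topological embedding of the solid torus S^1 x D^2 (compact source,
   Hausdorff target) with core K; its values off the solid torus are irrelevant. *)
Record tubular_nbhd (K : set (sphere 3)) (phi : 'rV[R]_2 * 'rV[R]_2 -> sphere 3) : Prop := {
  tubular_continuous : {within sphere 1 `*` disk 2, continuous phi};
  tubular_inj : {in sphere 1 `*` disk 2 &, injective phi};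
  tubular_core : phi @` (sphere 1 `*` [set 0]) = K
}.

(* Tame knots: a subset of S^3 homeomorphic to the circle is equivalent to a smooth or
   polygonal knot iff it is the core of an embedded solid torus. *)
Definition is_knot (K : set (sphere 3)) := exists phi, tubular_nbhd K phi.

Definition circle (s : R) : 'rV[R]_2 :=
  \row_i (if i == ord0 then cos (2 * pi * s) else sin (2 * pi * s)).

(* The boundary of a meridian disk of a tubular neighbourhood, parametrised by [0, 1].
   Both orientations occur, as phi may reverse the D^2 factor. *)
Definition is_meridian (K : set (sphere 3)) (m : R -> sphere 3) :=
  exists phi, tubular_nbhd K phi /\
  exists2 b, sphere 1 b & forall s, m s = phi (b, circle s).

(* In [covering_even], F is the family of sheets over U: injectivity, surjectivity onto U
   and openness say that q maps each sheet homeomorphically onto U. *)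
Record covering_map (E B : topologicalType) (q : E -> B) : Prop := {
  covering_continuous : continuous q;
  covering_surj : forall b, exists x, q x = b;
  covering_even : forall b, exists2 U, open_nbhs b U &
    exists2 F : set (set E),
      trivIset F id /\ \bigcup_(V in F) V = q @^-1` U &
      forall V, F V -> [/\ open V, {in V &, injective q}, q @` V = U &
        forall W, open W -> W `<=` V -> open (q @` W)]
}.

(* t^n for n : int, where t' is the inverse of t. *)
Definition int_iter (T : Type) (t t' : T -> T) (n : int) (x : T) : T :=
  match n with Posz k => iter k t x | Negz k => iter k.+1 t' x end.

(* A connected regular covering of S^3 \ K whose deck group is infinite cyclic, generated
   by [deck]. Since H_1(S^3 \ K; Z) = Z, it is unique up to isomorphism. [deck_transitive]
   says that the powers of [deck] act simply transitively on each fibre, hence, the total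
   space being connected, that they are all the deck transformations and are pairwise
   distinct. [deck_meridian] says that [deck] is the monodromy of a meridian. *)
Record infinite_cyclic_cover (K : set (sphere 3)) := {
  total :> topologicalType;
  proj : total -> ~` K;
  deck : continuousType total total;
  deck_inv : continuousType total total;
  proj_covering : covering_map proj;
  total_connected : connected [set: total];
  deckK : cancel deck deck_inv;
  deck_invK : cancel deck_inv deck;
  proj_deck : forall x, proj (deck x) = proj x;
  deck_transitive : forall x y, proj x = proj y ->
    exists! n : int, y = int_iter deck deck_inv n x;
  deck_meridian : exists2 m, is_meridian K m &
    forall c : R -> total, {within `[0, 1], continuous c} ->
      (forall s, 0 <= s <= 1 -> val (proj (c s)) = m s) ->
      c 1 = deck (c 0)
}.
End Knot.
Arguments sphere : clear implicits.
Arguments disk : clear implicits.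

(* Main.v *)
(* Let L be the Z_p-span, in H_1(X; Q_p), of the classes of finitely many generators of
   H_1(X; Z). The deck transformation maps L into itself, since it maps each generator to an
   integral combination of generators. A Q_p-cycle is a Q_p-combination of integral cycles,
   so L spans H_1(X; Q_p). Then L is compact, and it is a neighbourhood of 0: L \ pL is
   compact and avoids 0, hence stays at positive distance from 0, and every vector outside L
   has a multiple by a positive power of p, of no greater norm, in L \ pL. Since
   the lattices p^j L are a basis of neighbourhoods of 0 preserved by t_p, the measures of the
   Bowen balls lie between two positive constants independent of m, and dividing their
   logarithms by m gives 0 in the limit. *)
From HB Require Import structures.
Require Import Defs.
From mathcomp Require Import all_boot all_order all_algebra.
From mathcomp Require Import generic_quotient ring_quotient.
From mathcomp Require Import all_classical all_reals all_analysis.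
From mathcomp Require Import freeg zify ring lra.
Set Implicit Arguments. Unset Strict Implicit. Unset Printing Implicit Defensive.
Import Order.TTheory GRing.Theory Num.Theory.
Import numFieldNormedType.Exports.

Local Open Scope classical_set_scope.
Local Open Scope ring_scope.
Local Open Scope quotient_scope.

(** * The p-adic integers *)

Section PadicIntegers.
Variables (p : nat) (hp : prime p).

Lemma padic_abs_int (n : int) : padic_abs p n%:~R <= 1.
Proof.
rewrite /padic_abs; case: eqVneq => // n0.
have p1 : 1 < (p%:R : rat) by rewrite ltr1n prime_gt1.
rewrite -[n%:~R]divr1 -[1]/(1%:Q) padic_val_frac // -?(intr_eq0 rat) //.
by rewrite -[X in _ <= X](expr0z p%:R) ler_eXz2l // logn1; lia.
Qed.

Lemma padic_absXp (k : nat) : padic_abs p (p%:R ^+ k) = p%:R ^- k.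
Proof.
have p0 : (p%:R : rat) != 0 by rewrite pnatr_eq0 -lt0n prime_gt0.
have E : p%:R ^+ k = ((p ^ k)%N : int)%:~R / 1%:~R :> rat by rewrite divr1 -natrX.
rewrite /padic_abs expf_eq0 (negbTE p0) andbF [in LHS]E.
have pk0 : ((p ^ k)%N : int) != 0 by rewrite eqz_nat -lt0n expn_gt0 prime_gt0.
rewrite padic_val_frac //.
by rewrite pfactorK // logn1 subr0 -exprnN.
Qed.

(** The value group is discrete: an absolute value below 1 is at most [1/p]. *)
Lemma padic_abs_lt1 q : padic_abs p q < 1 -> padic_abs p (q / p%:R) <= 1.
Proof.
have p1 : 1 < (p%:R : rat) by rewrite ltr1n prime_gt1.
have p0 : 0 < (p%:R : rat) by rewrite ltr0n prime_gt0.
rewrite padic_absM // padic_absV // -[p%:R]expr1 padic_absXp expr1 invrK.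
rewrite -ler_pdivlMr // mul1r /padic_abs; case: eqVneq => [_ _|_].
  by rewrite invr_ge0 ltW.
rewrite -[X in _ < X](expr0z p%:R) ltr_eXz2l // => h.
by rewrite -exprN1 ler_eXz2l //; lia.
Qed.

(** The denominator of [q] is invertible modulo [p]; the digit is the residue of the numerator times
    that inverse. *)
Lemma padic_digit_rat q : padic_abs p q <= 1 ->
  exists2 d : nat, (d < p)%N & padic_abs p (q - d%:R) < 1.
Proof.
move=> q1; have p1 : 1 < (p%:R : rat) by rewrite ltr1n prime_gt1.
have pz : (p : int) != 0 by rewrite eqz_nat -lt0n prime_gt0.
(* If [p] divided the denominator, the numerator, in lowest terms, would be prime to [p] and the
   absolute value would exceed 1. *)
have cpd : coprimez p (denq q).
  rewrite /coprimez; apply: contraT => nc.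
  have pd : (p %| `|denq q|)%N.
    apply: contraNT nc => npd.
    by have := npd; rewrite -prime_coprime // /coprime /gcdz absz_nat => /eqP ->.
  have pn : ~~ (p %| `|numq q|)%N.
    have := coprime_num_den q; apply: contraTN => pn; apply/negP => /eqP cop.
    by have := dvdn_gcd p `|numq q| `|denq q|; rewrite pn pd cop /= dvdn1 => /eqP E;
       have := prime_gt1 hp; rewrite E.
  have q0 : q != 0 by apply: contraNneq pn => ->; rewrite dvdn0.
  move: q1; rewrite /padic_abs (negbTE q0) /padic_val -[X in _ <= X](expr0z p%:R) ler_eXz2l //.
  rewrite logn_coprime ?prime_coprime // sub0r opprK.
  have : (0 < logn p `|denq q|)%N by rewrite logn_gt0 mem_primes hp pd absz_gt0 denq_neq0.
  by lia.
(* Bezout, [a * p + b * denq q = 1]: [b] inverts the denominator modulo [p]. *)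
have [[a b] /= ab] := coprimezP _ _ cpd.
pose d := (numq q * b %% p)%Z.
have d0 : 0 <= d by rewrite modz_ge0.
have dp : d < p :> int by rewrite ltz_pmod // lt_def pz.
exists `|d|%N; first by lia.
have -> : (`|d|%N%:R : rat) = d%:~R by rewrite -[in RHS](gez0_abs d0) pmulrn.
have [->|s0] := eqVneq (q - d%:~R) 0; first by rewrite padic_abs0.
have dq : (denq q)%:~R != 0 :> rat by rewrite intr_eq0 denq_neq0.
have E : q - d%:~R = (numq q - d * denq q)%:Q / (denq q)%:Q.
  by rewrite intrB intrM mulrBl mulfK // divq_num_den.
have n0 : numq q - d * denq q != 0 by apply: contraNneq s0 => n0; rewrite E n0 mul0r.
rewrite /padic_abs (negbTE s0) E padic_val_frac ?denq_neq0 //.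
rewrite -[X in _ < X](expr0z p%:R) ltr_eXz2l // oppr_lt0.
have -> : logn p `|denq q| = 0%N.
  by apply: logn_coprime; exact: cpd.
rewrite subr0 ltz_nat logn_gt0 mem_primes hp absz_gt0 n0 /=.
have : ((p : int) %| numq q - d * denq q)%Z.
  have -> : numq q - d * denq q = (p : int) * (a * numq q + (numq q * b %/ p)%Z * denq q).
    have := divz_eq (numq q * b) p; rewrite -/d; set c := (_ %/ _)%Z => hd.
    have -> : d = numq q * b - c * (p : int) by rewrite hd; ring.
    rewrite -[X in X - _]mulr1 -ab; ring.
  exact: dvdz_mulr.
by rewrite dvdzE.
Qed.

Lemma const_cauchy (q : rat) : (fun _ => q) \in cauchy_seq hp.
Proof. by apply/cauchy_seqP => e e0; exists 0%N => *; rewrite subrr padic_abs0. Qed.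

Definition const_cauchy_seq (q : rat) : padic_cauchy hp := SigSub (const_cauchy q).

Definition padic_rat (q : rat) : padic hp := \pi_(padic hp) (const_cauchy_seq q).

Lemma val_scale (a : rat) (u : padic_cauchy hp) n :
  val (const_cauchy_seq a * u) n = a * val u n.
Proof. by []. Qed.

Lemma val_scale_sub (a b : rat) (u : padic_cauchy hp) n :
  val (const_cauchy_seq a * (u - const_cauchy_seq b)) n = a * (val u n - b).
Proof. by []. Qed.

Lemma padic_rat_zmod : zmod_morphism padic_rat.
Proof.
move=> x y; rewrite /padic_rat -rmorphB; congr (\pi _); exact: val_inj.
Qed.
HB.instance Definition _ := GRing.isZmodMorphism.Build _ _ padic_rat padic_rat_zmod.

Lemma padic_rat_monoid : monoid_morphism padic_rat.
Proof.
split; first by rewrite /padic_rat -(rmorph1 (\pi_(padic hp))); congr (\pi _); exact: val_inj.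
by move=> x y; rewrite /padic_rat -rmorphM; congr (\pi _); exact: val_inj.
Qed.
HB.instance Definition _ := GRing.isMonoidMorphism.Build _ _ padic_rat padic_rat_monoid.

Lemma padic_eqP (u v : padic_cauchy hp) :
  \pi_(padic hp) u = \pi_(padic hp) v <-> u - v \in @null_cauchy p hp.
Proof.
rewrite Quotient.idealrBE; split => [->//|/eqP //].
Qed.

(** Z_p through rational representatives, so that digits can be read off without the real-valued
    norm. *)
Definition padic_int (x : padic hp) : Prop :=
  exists2 u : padic_cauchy hp, x = \pi_(padic hp) u &
    exists N, forall n, (N <= n)%N -> padic_abs p (val u n) <= 1.

Lemma padic_intr (n : int) : padic_int n%:~R.
Proof.
exists (const_cauchy_seq n%:~R); last by exists 0%N => m _; exact: padic_abs_int.
by rewrite -[RHS]/(padic_rat _) rmorph_int.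
Qed.

Lemma padic_intD x y : padic_int x -> padic_int y -> padic_int (x + y).
Proof.
move=> [u -> [N hu]] [v -> [M hv]]; exists (u + v); first by rewrite rmorphD.
exists (maxn N M) => n; rewrite geq_max => /andP[Nn Mn].
rewrite [val _ n]/(val u n + val v n) (le_trans (padic_absD hp _ _)) //.
by rewrite ge_max hu ?hv.
Qed.

Lemma padic_intM x y : padic_int x -> padic_int y -> padic_int (x * y).
Proof.
move=> [u -> [N hu]] [v -> [M hv]]; exists (u * v); first by rewrite rmorphM.
exists (maxn N M) => n; rewrite geq_max => /andP[Nn Mn].
by rewrite [val _ n]/(val u n * val v n) padic_absM // mulr_ile1 ?padic_abs_ge0 ?hu ?hv.
Qed.

Lemma natr_padic_neq0 : (p%:R : padic hp) != 0.
Proof.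
have -> : (p%:R : padic hp) = padic_rat p%:R by rewrite rmorph_nat.
by rewrite fmorph_eq0 pnatr_eq0 -lt0n prime_gt0.
Qed.

(** Terms beyond [L] differ by less than 1 in absolute value, so all share the digit of the term at
    [L]; subtracting it leaves a multiple of [p]. *)
Lemma padic_digit x : padic_int x ->
  exists2 d : nat, (d < p)%N & exists2 y, padic_int y & x = d%:R + p%:R * y.
Proof.
move=> [u -> [N hN]].
have /cauchy_seqP /(_ 1 ltr01) [M hM] := valP u.
pose L := maxn N M.
have [|d dp hd] := @padic_digit_rat (val u L); first by rewrite hN // leq_maxl.
exists d => //.
exists (padic_rat p%:R^-1 * (\pi_(padic hp) u - padic_rat d%:R)).
  rewrite /padic_rat -rmorphB -rmorphM; eexists; first by [].
  exists L => n Ln.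
  rewrite val_scale_sub mulrC; apply: padic_abs_lt1.
  rewrite -(subrKA (val u L)) (le_lt_trans (padic_absD hp _ _)) // gt_max hd andbT.
  by apply: hM; rewrite ?leq_maxr // (leq_trans _ Ln) ?leq_maxr.
by rewrite mulrA fmorphV rmorph_nat divff ?natr_padic_neq0 // mul1r rmorph_nat addrC subrK.
Qed.

(** A Cauchy sequence is eventually bounded, and the powers of [p] outgrow the bound. *)
Lemma padic_unscale x : exists k, padic_int (p%:R ^+ k * x).
Proof.
rewrite -[x]reprK; set u := repr x.
have [c [c0 [N hN]]] := cauchy_bounded (valP u).
have [k hk] : exists k, c <= p%:R ^+ k.
  exists (Num.truncn c).+1.
  apply: (le_trans (ltW (truncnS_gt c))); rewrite -natrX ler_nat.
  by apply/ltnW/ltn_expl/prime_gt1.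
exists k, (const_cauchy_seq (p%:R ^+ k) * u).
  by rewrite rmorphM; congr (_ * _); rewrite -[RHS]/(padic_rat _) rmorphXn rmorph_nat.
exists N => n Nn; rewrite val_scale padic_absM // padic_absXp.
by rewrite mulrC ler_pdivrMr ?exprn_gt0 ?ltr0n ?prime_gt0 // mul1r (le_trans (hN _ Nn)).
Qed.

(** Completeness of Z_p: the partial sums [u] are Cauchy because [u n] and [u k] agree modulo [p^k]
    for [n >= k]; [z] is the tail divided by [p^k]. *)
Lemma padic_digit_series (d : nat -> nat) : exists x, forall k,
  exists2 z, padic_int z & x = \sum_(j < k) (d j)%:R * p%:R ^+ j + p%:R ^+ k * z.
Proof.
pose s n := (\sum_(j < n) d j * p ^ j)%N.
pose u : nat -> rat := fun n => (s n)%:R.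
have hs k n : (k <= n)%N -> exists b : nat, u n - u k = p%:R ^+ k * b%:R.
  move=> kn; rewrite /u; exists (\sum_(k <= j < n) d j * p ^ (j - k))%N.
  have -> : s n = (s k + p ^ k * \sum_(k <= j < n) d j * p ^ (j - k))%N.
    rewrite /s -!(big_mkord xpredT (fun j => d j * p ^ j)%N) [LHS](@big_cat_nat _ _ _ k) //=.
    congr addn; rewrite big_distrr /= !big_nat; apply: eq_bigr => j /andP[kj _].
    by rewrite mulnCA -expnD subnKC.
  by rewrite natrD natrM natrX addrAC subrr add0r.
have hu k n : (k <= n)%N -> padic_abs p (u n - u k) <= p%:R ^- k.
  move=> /hs [b ->]; rewrite padic_absM // padic_absXp ler_piMr ?invr_ge0 ?exprn_ge0 //.
  by rewrite -[b%:R]/(b%:~R) padic_abs_int.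
have p1 : 1 < (p%:R : rat) by rewrite ltr1n prime_gt1.
have cu : u \in cauchy_seq hp.
  apply/cauchy_seqP => e e0.
  (* [e^-1 < k < p^k], whence [p^-k < e]. *)
  pose k := (Num.truncn e^-1).+1.
  have ke : p%:R ^- k < e.
    rewrite invf_plt ?posrE // ?exprn_gt0 ?(lt_trans ltr01) //.
    apply: (lt_trans (truncnS_gt _)); rewrite -/k -natrX ltr_nat.
    by apply/ltn_expl/prime_gt1.
  exists k => m n km kn.
  rewrite -(subrKA (u k)) (le_lt_trans (padic_absD hp _ _)) // gt_max.
  by rewrite [padic_abs p (u k - _)]padic_abs_sym // !(le_lt_trans _ ke) ?hu.
exists (\pi_(padic hp) (SigSub cu : padic_cauchy hp)) => k.
have E : \sum_(j < k) (d j)%:R * p%:R ^+ j = padic_rat (u k).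
  rewrite /u rmorph_nat /s natr_sum; apply: eq_bigr => j _.
  by rewrite natrM natrX.
exists (padic_rat (p%:R ^- k) * (\pi_(padic hp) (SigSub cu : padic_cauchy hp) - padic_rat (u k))).
  rewrite /padic_rat -rmorphB -rmorphM; eexists; first by [].
  exists k => n kn; rewrite val_scale_sub.
  have [b ->] := hs _ _ kn.
  rewrite mulrA mulVf ?mul1r ?expf_neq0 ?lt0r_neq0 ?(lt_trans ltr01) //.
  by rewrite -[b%:R]/(b%:~R) padic_abs_int.
have -> : (p%:R ^+ k : padic hp) = padic_rat (p%:R ^+ k) by rewrite rmorphXn rmorph_nat.
rewrite E mulrA -rmorphM divff ?expf_neq0 ?lt0r_neq0 ?(lt_trans ltr01) //.
by rewrite rmorph1 mul1r addrC subrK.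
Qed.

(** * The real-valued norm on Q_p *)

Section PadicNorm.
Variable R : realType.

(** By the ultrametric inequality, a Cauchy sequence bounded away from 0 has eventually constant
    absolute value, so the limit is attained. *)
Lemma padic_norm_near (x : padic hp) (r := repr x) : x != 0 ->
  exists N, forall n, (N <= n)%N -> padic_norm R x = ratr (padic_abs p (val r n)).
Proof.
move=> x0.
have : r \notin @null_cauchy p hp.
  apply: contra x0 => hr; rewrite -[x]reprK -/r; apply/eqP.
  by rewrite -(rmorph0 (\pi_(padic hp))); apply/padic_eqP; rewrite subr0.
move=> /not_null_cauchy [c [c0 [N hN]]].
have /cauchy_seqP /(_ c c0) [M hM] := valP r.
exists (maxn N M).
suff H : forall m n, (maxn N M <= m)%N -> (maxn N M <= n)%N ->
    padic_abs p (val r m) <= padic_abs p (val r n).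
  move=> n Ln; rewrite /padic_norm -/r; apply: lim_near_cst => //.
  exists (maxn N M) => // m /= Lm; congr ratr.
  by apply/eqP; rewrite eq_le !H.
move=> m n; rewrite !geq_max => /andP[Nm Mm] /andP[Nn Mn].
have := padic_absD hp (val r m - val r n) (val r n); rewrite subrK.
move=> h; apply: (le_trans h); rewrite ge_max lexx andbT ltW //.
by apply: (lt_le_trans (hM _ _ Mm Mn)); exact: hN.
Qed.

Lemma padic_norm_int x : padic_int x -> padic_norm R x <= 1.
Proof.
have [->|x0] := eqVneq x 0; first by rewrite padic_norm0.
move=> [u xu [N hN]]; have [M hM] := padic_norm_near x0.
(* The norm is computed on [repr x], which eventually differs from [u] by less than 1. *)
have : repr x - u \in @null_cauchy p hp by apply/padic_eqP; rewrite reprK.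
move=> /null_cauchyP /(_ 1 ltr01) [L hL].
pose n := maxn N (maxn M L).
have Nn : (N <= n)%N by rewrite leq_maxl.
have Mn : (M <= n)%N by rewrite /n maxnCA leq_maxl.
have Ln : (L <= n)%N by rewrite /n maxnA leq_maxr.
rewrite (hM n) // -(rmorph1 (@ratr R)) ler_rat.
rewrite -(subrK (val u n) (val (repr x) n)) (le_trans (padic_absD hp _ _)) //.
by rewrite ge_max hN // andbT ltW // (hL n Ln).
Qed.

Lemma padic_normp_le : padic_norm R (p%:R : padic hp) <= p%:R^-1.
Proof.
have [M hM] := padic_norm_near natr_padic_neq0.
have : repr (p%:R : padic hp) - const_cauchy_seq p%:R \in @null_cauchy p hp.
  by apply/padic_eqP; rewrite reprK -[RHS]/(padic_rat _) rmorph_nat.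
have p0 : 0 < (p%:R : rat) by rewrite ltr0n prime_gt0.
move=> /null_cauchyP /(_ p%:R^-1) [|L hL]; first by rewrite invr_gt0.
pose n := maxn M L; rewrite (hM n) ?leq_maxl // -(ratr_nat R p) -fmorphV ler_rat.
rewrite -(subrK p%:R (val _ n)) (le_trans (padic_absD hp _ _)) // ge_max.
have -> : padic_abs p p%:R = p%:R^-1 by rewrite -{1}(expr1 p%:R) padic_absXp expr1.
rewrite lexx andbT ltW //.
by apply: hL; rewrite leq_maxr.
Qed.
End PadicNorm.
End PadicIntegers.

(** * Lattices in a normed Q_p-vector space *)

Section PadicLattice.
Variables (p : nat) (hp : prime p) (V : lmodType (padic hp)) (n : nat) (v : 'I_n -> V).

Definition padic_lattice : set V :=
  [set w | exists2 x, (forall i, padic_int (x i)) & w = \sum_i x i *: v i].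
Local Notation L := padic_lattice.

Lemma padic_latticeD w z : L w -> L z -> L (w + z).
Proof.
move=> [x hx ->] [y hy ->]; exists (fun i => x i + y i).
  by move=> i; exact: padic_intD.
by rewrite -big_split; apply: eq_bigr => i _; rewrite scalerDl.
Qed.

Lemma padic_latticeZ a w : padic_int a -> L w -> L (a *: w).
Proof.
move=> ha [x hx ->]; exists (fun i => a * x i).
  by move=> i; exact: padic_intM.
by rewrite scaler_sumr; apply: eq_bigr => i _; rewrite scalerA.
Qed.

Lemma padic_latticeB w z : L w -> L z -> L (w - z).
Proof.
move=> hw hz; apply: padic_latticeD => //.
by rewrite -scaleN1r; apply: padic_latticeZ => //; exact: (padic_intr hp (- 1)).
Qed.

Lemma padic_lattice0 : L 0.
Proof.
by exists (fun=> 0) => [i|]; [exact: (padic_intr hp 0)|rewrite big1 // => i _; rewrite scale0r].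
Qed.

Lemma padic_lattice_sum (m : nat) (f : 'I_m -> V) : (forall i, L (f i)) -> L (\sum_i f i).
Proof.
move=> hf; elim/big_ind : _ => // [|x y]; [exact: padic_lattice0|exact: padic_latticeD].
Qed.

Lemma padic_int_exp k : padic_int (p%:R ^+ k : padic hp).
Proof.
elim: k => [|k IH]; first exact: (padic_intr hp 1).
by rewrite exprS; apply: padic_intM => //; exact: (padic_intr hp p).
Qed.

(** Representatives of L modulo pL. The index type is finite, as the ultrafilter argument
    requires. *)
Definition digit_comb (a : {ffun 'I_n -> 'I_p}) : V := \sum_i ((a i : nat)%:R : padic hp) *: v i.

Lemma padic_lattice_digit w : L w ->
  exists a, exists2 z, L z & w = digit_comb a + (p%:R : padic hp) *: z.
Proof.
move=> [x hx ->].
have /choice[f hf] : forall i, exists dy : 'I_p * padic hp,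
    padic_int dy.2 /\ x i = (dy.1 : nat)%:R + p%:R * dy.2.
  by move=> i; have [d dp [y hy ->]] := padic_digit (hx i); exists (Ordinal dp, y).
exists [ffun i => (f i).1], (\sum_i (f i).2 *: v i).
  by exists (fun i => (f i).2) => // i; case: (hf i).
rewrite /digit_comb scaler_sumr -big_split; apply: eq_bigr => i _ /=.
by rewrite ffunE scalerA -scalerDl; case: (hf i) => _ <-.
Qed.

(** Completeness of L, one coordinate at a time. *)
Lemma padic_lattice_series (a : nat -> {ffun 'I_n -> 'I_p}) : exists w, forall k,
  exists2 z, L z &
    w = \sum_(j < k) (p%:R ^+ j : padic hp) *: digit_comb (a j) + (p%:R ^+ k : padic hp) *: z.
Proof.
have /choice[x hx] := fun i => padic_digit_series hp (fun j => a j i : nat).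
exists (\sum_i x i *: v i) => k.
have /choice[z hz] : forall i, exists z, padic_int z /\
    x i = \sum_(j < k) (a j i : nat)%:R * p%:R ^+ j + p%:R ^+ k * z.
  by move=> i; have [z ? ?] := hx i k; exists z.
exists (\sum_i z i *: v i); first by exists z => // i; case: (hz i).
under [X in X + _]eq_bigr => j _ do rewrite /digit_comb scaler_sumr.
rewrite exchange_big /= scaler_sumr -big_split; apply: eq_bigr => i _ /=.
have [_ ->] := hz i; rewrite scalerDl scalerA scaler_suml; congr (_ + _).
by apply: eq_bigr => j _; rewrite scalerA mulrC.
Qed.

Lemma padic_lattice_unscale w : (exists x, w = \sum_i x i *: v i) ->
  exists k, L ((p%:R ^+ k : padic hp) *: w).
Proof.
move=> [x ->]; have /choice[k hk] := fun i => padic_unscale (x i).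
(* The sum of the exponents dominates each of them, so it serves all coordinates at once. *)
exists (\sum_i k i)%N; rewrite scaler_sumr; apply: padic_lattice_sum => i.
exists (fun j => if j == i then p%:R ^+ (\sum_i k i)%N * x i else 0).
  move=> j; case: eqP => _; last exact: (padic_intr hp 0).
  rewrite (bigD1 i) //= addnC exprD -mulrA; apply: padic_intM => //.
  exact: padic_int_exp.
rewrite [RHS](bigD1 i) //= eqxx scalerA [X in _ + X]big1 ?addr0 // => j /negbTE ->.
by rewrite scale0r.
Qed.

End PadicLattice.

(** * Compactness and openness of the lattice *)

Section NormedLattice.
Variables (R : realType) (p : nat) (hp : prime p) (V : lmodType (padic hp)) (N : vnorm R V).
Variables (n : nat) (v : 'I_n -> V).
Local Notation L := (padic_lattice v).
Local Notation W := (normed_space N).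
Local Notation pi_ k := (p%:R ^+ k : padic hp).

Lemma vnorm_ge0 w : 0 <= N w.
Proof.
have := vnormD N w (- w); rewrite subrr vnorm0 vnormN -mulr2n => h.
by rewrite -(@pmulrn_lge0 _ _ 2).
Qed.

Lemma vnormZ_int a w : padic_int a -> N (a *: w) <= N w.
Proof. by move=> ha; rewrite vnormZ ler_piMl ?vnorm_ge0 ?padic_norm_int. Qed.

Lemma vnormZ_exp k w : N (pi_ k *: w) <= p%:R ^- k * N w.
Proof.
elim: k w => [|k IH] w; first by rewrite !expr0 scale1r invr1 mul1r.
rewrite exprSr -scalerA (le_trans (IH _)) // vnormZ exprS invfM mulrA.
rewrite ler_wpM2r ?vnorm_ge0 // mulrC ler_wpM2r ?invr_ge0 ?exprn_ge0 //.
exact: padic_normp_le.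
Qed.

Lemma vnorm_lattice_bounded : exists2 M, 0 < M & forall w, L w -> N w <= M.
Proof.
exists (1 + \sum_i N (v i)).
  by rewrite ltr_pwDl // sumr_ge0 // => i _; exact: vnorm_ge0.
move=> w [x hx ->]; rewrite ler_wpDl //.
elim/big_ind2 : _ => [|a b c d h1 h2|i _]; first by rewrite vnorm0.
  by rewrite (le_trans (vnormD _ _ _)) // lerD.
exact: vnormZ_int.
Qed.

Lemma vnorm_lattice_small e : 0 < e -> exists k, forall w, L w -> N (pi_ k *: w) < e.
Proof.
move=> e0; have [M M0 hM] := vnorm_lattice_bounded.
(* [M / e < k < p^k], whence [p^-k * M < e]. *)
exists (Num.truncn (M / e)).+1 => w Lw; set k := _.+1.
rewrite (le_lt_trans (vnormZ_exp _ _)) // (le_lt_trans (y := p%:R ^- k * M)) //.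
  by rewrite ler_wpM2l ?invr_ge0 ?exprn_ge0 // hM.
rewrite mulrC ltr_pdivrMr ?exprn_gt0 ?ltr0n ?prime_gt0 // mulrC -ltr_pdivrMr //.
apply: (lt_trans (truncnS_gt _)); rewrite -/k -natrX ltr_nat.
by apply/ltn_expl/prime_gt1.
Qed.

Lemma vballE (x : W) e : ball x e = [set y : W | N ((x : V) - y) < e].
Proof. by rewrite ballEmdist. Qed.

Lemma vball_open (x : W) e : open (ball x e).
Proof.
rewrite openE vballE => y /= xy; apply/nbhs_ballP.
exists (e - N ((x : V) - y)); first by rewrite /= subr_gt0.
rewrite vballE => z /=; rewrite ltrBrDl; apply: le_lt_trans.
by rewrite -(subrKA (y : V)) vnormD.
Qed.

Definition lattice_coset (w : V) k : set V := [set u | exists2 z, L z & u = w + pi_ k *: z].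

(** A coset of [p^k L] is covered by finitely many cosets of [p^k.+1 L], one for each digit
    combination, and an ultrafilter containing a finite union contains one of its pieces. *)
Lemma lattice_coset_ultra (F : set_system W) (w : W) k : UltraFilter F ->
  F (lattice_coset w k) -> exists a, F (lattice_coset (w + pi_ k *: digit_comb v a) k.+1).
Proof.
move=> UF FC; apply: contrapT => h.
have FN a : F (~` lattice_coset (w + pi_ k *: digit_comb v a) k.+1).
  have [Fa|//] := in_ultra_setVsetC (lattice_coset (w + pi_ k *: digit_comb v a) k.+1) UF.
  by exfalso; apply: h; exists a.
have FF : F [set u | forall a, (~` lattice_coset (w + pi_ k *: digit_comb v a) k.+1) u].
  exact: filter_forall.
have [u [[z Lz uE] hu]] := filter_ex (filterI FC FF).
have [a [y Ly zE]] := padic_lattice_digit Lz.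
apply: (hu a); exists y => //.
by rewrite uE zE scalerDr scalerA exprSr addrA.
Qed.

(** Choosing ever smaller cosets in [F] yields a digit expansion, whose sum [w] is the limit, since
    the cosets [w + p^k L] shrink to [w]. The last conclusion serves to keep [w] out of pL in the
    next compactness proof. *)
Lemma lattice_ultra (F : set_system W) : UltraFilter F -> F (L : set W) ->
  exists w : W, [/\ L w, F --> w & F (lattice_coset w 1)].
Proof.
move=> UF FL.
have /choice[f hf] : forall wk : W * nat, exists a, F (lattice_coset wk.1 wk.2) ->
    F (lattice_coset (wk.1 + pi_ wk.2 *: digit_comb v a) wk.2.+1).
  move=> [w k] /=; have [/(lattice_coset_ultra UF)[a ha]|h] := pselect (F (lattice_coset w k)).
    by exists a.
  by exists [ffun=> Ordinal (prime_gt0 hp)] => /h.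
(* [s k] collects the first [k] digits, chosen by [f] so that [F] contains [s k + p^k L]. *)
pose s := fix s k : V := if k is k'.+1 then s k' + pi_ k' *: digit_comb v (f (s k', k')) else 0.
have Fs k : F (lattice_coset (s k) k).
  elim: k => [|k IH] /=; last exact: (hf (s k, k)).
  apply: filterS FL => w Lw; exists w => //.
  by rewrite expr0 scale1r add0r.
have [w hw] := padic_lattice_series v (fun k => f (s k, k)).
have {}hw k : exists2 z, L z & w = s k + pi_ k *: z.
  have [z Lz wE] := hw k; exists z => //; rewrite wE; congr (_ + _).
  by elim: k {z Lz wE} => [|k IH]; rewrite ?big_ord0 // big_ord_recr /= IH.
(* [w] and [s k] differ by an element of [p^k L], so they define the same coset. *)
have Fw k : F (lattice_coset w k).
  have [z Lz wE] := hw k; apply: filterS (Fs k) => u [y Ly ->].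
  exists (y - z); first exact: padic_latticeB.
  by rewrite wE scalerBr -addrA [X in _ = _ + X]addrC subrK.
exists w; split => //.
  by have [z Lz ->] := hw 0%N; rewrite expr0 scale1r add0r.
move=> A /nbhs_ballP[e /= e0]; rewrite vballE => eA.
have [k hk] := vnorm_lattice_small e0.
apply: filterS (Fw k) => u [z Lz ->]; apply: eA => /=.
by rewrite opprD addrA subrr add0r vnormN hk.
Qed.

Lemma padic_lattice_compact : compact (L : set W).
Proof.
rewrite compact_ultra => F UF FL.
by have [w [Lw Fw _]] := lattice_ultra UF FL; exists w.
Qed.

(** Openness of pL is not yet available. Instead, the ultrafilter contains both L \ pL and [w + pL];
    these would be disjoint if [w] were in pL. *)
Lemma primitive_lattice_compact : compact (L `\` [set pi_ 1 *: z | z in L] : set W).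
Proof.
rewrite compact_ultra => F UF FD.
have [|w [Lw Fw F1]] := lattice_ultra UF; first by apply: filterS FD => u [].
exists w; split => //; split => // -[y Ly yw].
have [u [[_ nu] [z Lz uE]]] := filter_ex (filterI FD F1); apply: nu.
exists (y + z); first exact: padic_latticeD.
by rewrite uE -yw scalerDr.
Qed.

Hypothesis v_span : forall w, exists x, w = \sum_i x i *: v i.

(* If w is not in L, its first p-power multiple in L lies in L \ pL and has norm at most that
   of w, while the compact set L \ pL is at positive distance from 0. *)
Lemma padic_lattice_open : exists2 m, 0 < m & forall w, N w < m -> L w.
Proof.
have cD : open (~` (L `\` [set pi_ 1 *: z | z in L] : set W)).
  by apply: closed_openC; apply: compact_closed primitive_lattice_compact; exact: metric_hausdorff.
have : nbhs (0 : W) (~` (L `\` [set pi_ 1 *: z | z in L] : set W)).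
  apply: open_nbhs_nbhs; split => //= -[_]; apply; exists 0; last by rewrite scaler0.
  exact: padic_lattice0.
move=> /nbhs_ballP[m /= m0]; rewrite vballE => hm; exists m => // w wm.
have : exists k, `[< L (pi_ k *: w) >].
  by have [k hk] := padic_lattice_unscale (v_span w); exists k; exact/asboolP.
case/ex_minnP => -[|j] /asboolP Lj jmin; first by rewrite expr0 scale1r in Lj.
have := hm (pi_ j.+1 *: w); rewrite /= sub0r vnormN => /(_ _)[].
  by rewrite (le_lt_trans _ wm) // vnormZ_int //; exact: padic_int_exp.
(* Cancelling one factor [p] would put [p^j w] in L, against the minimality of [j.+1]. *)
split=> // -[z Lz]; rewrite [pi_ j.+1]exprS -scalerA expr1 => /(scalerI (natr_padic_neq0 hp)) zE.
have /jmin : `[< L (pi_ j *: w) >] by apply/asboolP; rewrite -zE.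
by rewrite ltnn.
Qed.

Lemma padic_lattice_open_scale k : exists2 m, 0 < m & forall w, N w < m ->
  exists2 z, L z & w = pi_ k *: z.
Proof.
have [m m0 hm] := padic_lattice_open.
(* A positive bound for the factor by which multiplication by [p^-k] enlarges the norm. *)
pose c := 1 + `|padic_norm R (pi_ k)^-1|.
have c0 : 0 < c by rewrite ltr_wpDr.
exists (m / c); first exact: divr_gt0.
move=> w wm; exists ((pi_ k)^-1 *: w); last first.
  by rewrite scalerA divff ?scale1r // expf_neq0 // natr_padic_neq0.
apply: hm; rewrite vnormZ; move: wm; rewrite ltr_pdivlMr //.
apply: le_lt_trans; rewrite mulrC ler_wpM2l ?vnorm_ge0 //.
by rewrite (le_trans (ler_norm _)) // lerDr.
Qed.

End NormedLattice.

(** * Entropy of an endomorphism preserving a lattice *)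

(** The logarithms stay between [ln c] and [ln d], so division by [k] sends them to 0. The index 0
    is excluded because the Bowen ball there is an empty intersection, the whole space. *)
Lemma cvg_log_average (R : realType) (b : nat -> \bar R) (c d : R) : 0 < c ->
  (forall k, (0 < k)%N -> (c%:E <= b k <= d%:E)%E) ->
  (fun k => - (k%:R^-1%:E * lne (b k)))%E @ \oo --> 0%E.
Proof.
move=> c0 hb.
have hln k : (0 < k)%N -> exists2 x, lne (b k) = x%:E & ln c <= x <= ln d.
  move=> /hb; case: (b k) => [x| |]; rewrite ?leye_eq ?leeNy_eq ?andbF // !lee_fin => /andP[cx xd].
  have x0 := lt_le_trans c0 cx; exists (ln x).
    by rewrite /lne leNgt x0.
  by rewrite !ler_ln ?posrE ?cx ?(lt_le_trans x0 xd).
apply/fine_cvgP; split.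
  by exists 1%N => // k /= /hln[x -> _].
apply/cvgr0Pnorm_le => e e0.
pose C := `|ln c| + `|ln d|.
exists (Num.truncn (C / e)).+1 => // k /= hk.
have k0 : (0 < k)%N by exact: leq_ltn_trans hk.
have [x -> /andP[cx xd]] := hln _ k0.
rewrite /= normrN normrM ger0_norm ?invr_ge0 // mulrC ler_pdivrMr ?ltr0n //.
rewrite (@le_trans _ _ C) //.
  have := ler_norm (- ln c); have := ler_norm (ln d).
  have := normr_ge0 (ln c); have := normr_ge0 (ln d).
  by rewrite /C normrN ler_norml => *; apply/andP; split; lra.
by rewrite mulrC -ler_pdivrMr // (le_trans (ltW (truncnS_gt _))) // ler_nat.
Qed.

Lemma open_measurable_borel (G : ptopologicalType) (A : set G) : open A ->
  measurable (A : set (borel_type G)).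
Proof. exact: sub_sigma_algebra. Qed.

Section LatticeEntropy.
Variables (R : realType) (p : nat) (hp : prime p) (V : lmodType (padic hp)) (N : vnorm R V).
Variables (n : nat) (v : 'I_n -> V).
Local Notation L := (padic_lattice v).
Local Notation W := (normed_space N).
Local Notation pi_ k := (p%:R ^+ k : padic hp).
Hypothesis v_span : forall w, exists x, w = \sum_i x i *: v i.
Variable T : {linear V -> V}.
Hypothesis TL : forall i, L (T (v i)).

(** By linearity, stability of L under [T] follows from its generators and passes to every
    [p^j L]. *)
Lemma iter_lattice j k w : L w -> exists2 z, L z & iter k T (pi_ j *: w) = pi_ j *: z.
Proof.
move=> Lw; exists (iter k T w).
  elim: k => //= k [x hx ->]; rewrite linear_sum; apply: padic_lattice_sum => i.
  by rewrite linearZ; exact: padic_latticeZ.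
by elim: k => //= k ->; rewrite linearZ.
Qed.

Lemma iterB k w z : iter k T (w - z) = iter k T w - iter k T z.
Proof. by elim: k => //= k ->; rewrite linearB. Qed.

(** Some [p^j L] fits in the [e]-ball and contains a [d]-ball; being stable under all iterates, it
    makes [d] independent of [k]. *)
Lemma iter_equicontinuous e : 0 < e ->
  exists2 d, 0 < d & forall k w, N w < d -> N (iter k T w) < e.
Proof.
move=> e0; have [j hj] := vnorm_lattice_small N v e0.
have [d d0 hd] := padic_lattice_open_scale N v_span j.
exists d => // k w /hd[z Lz ->]; have [y Ly ->] := iter_lattice j k Lz; exact: hj.
Qed.

Lemma iter_continuous k : continuous (iter k T : W -> W).
Proof.
move=> x A /nbhs_ballP[e /= e0]; rewrite vballE => eA.
have [d d0 hd] := iter_equicontinuous e0.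
apply/nbhs_ballP; exists d => //= y; rewrite vballE /= => xy; apply: eA => /=.
by rewrite -iterB; exact: hd.
Qed.

Lemma bowen_ball_measurable e m :
  measurable (bowen_ball (0 : W) (T : W -> W) e m : set (borel_type W)).
Proof.
apply: bigcap_measurableType => k _; apply: open_measurable_borel.
by apply: open_comp => [x _|]; [exact: iter_continuous|exact: vball_open].
Qed.

Variables (mu : {measure set (borel_type W) -> \bar R}).
Hypothesis hmu : haar_measure mu.

Lemma lattice_entropy : has_entropy (0 : W) mu (T : W -> W) 0%E.
Proof.
have [m m0 hm] := padic_lattice_open N v_span.
have cL : compact (L : set W) by exact: padic_lattice_compact.
have mL : measurable (L : set (borel_type W)).
  rewrite -[L]setCK; apply: measurableC; apply: open_measurable_borel; apply: closed_openC.
  by apply: compact_closed cL; exact: metric_hausdorff.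
(* Once the [e]-ball lies in L, the entropy at scale [e] is exactly 0, so the limit is that of an
   eventually constant function. *)
suff H e : 0 < e -> e < m -> entropy_scale (0 : W) mu (T : W -> W) e = 0%E.
  apply: cvg_near_cst; near=> e; apply: H; near: e.
    exact: nbhs_right_gt.
  exact: nbhs_right_lt.
move=> e0 em.
have [d d0 hd] := iter_equicontinuous e0.
have mb : measurable (ball (0 : W) d : set (borel_type W)).
  by apply: open_measurable_borel; exact: vball_open.
have b0 : (0 < mu (ball (0%R : W) d))%E.
  by apply: haar_open => //; [exact: vball_open|exists (0%R : W); exact: ballxx].
(* The iterate of index 0 alone confines the Bowen ball to the [e]-ball, hence to L. *)
have bowenL k : (0 < k)%N -> bowen_ball (0 : W) (T : W -> W) e k `<=` L.
  move=> k0 w /(_ 0%N k0); rewrite vballE /= sub0r vnormN => we.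
  by apply: hm; exact: lt_trans em.
have subb k : ball (0 : W) d `<=` bowen_ball (0 : W) (T : W -> W) e k.
  move=> w; rewrite vballE /= sub0r vnormN => wd j _ /=.
  by rewrite vballE /= sub0r vnormN; exact: hd.
have Loo := haar_compact hmu cL.
have Lfin : mu L \is a fin_num by rewrite ge0_fin_numE.
have bfin : mu (ball (0 : W) d) \is a fin_num.
  rewrite ge0_fin_numE // (le_lt_trans _ Loo) // le_measure ?inE //.
  exact: subset_trans (subb 1%N) (bowenL 1%N _).
(* A convergent sequence has its limit as limsup. *)
apply: (cvg_limn_einf_sup _).2.
apply: (@cvg_log_average _ _ (fine (mu (ball (0 : W) d))) (fine (mu L))).
  by rewrite fine_gt0 // b0 -ge0_fin_numE.
move=> k k0; rewrite !fineK //; apply/andP; split.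
  by apply: le_measure; rewrite ?inE //; exact: bowen_ball_measurable.
by apply: le_measure; rewrite ?inE //; [exact: bowen_ball_measurable|exact: bowenL].
Unshelve. all: by end_near.
Qed.
End LatticeEntropy.

(** * Extension of coefficients in homology *)

Section FreegExtension.
Variable k : nzRingType.

(** Change of coefficients along the ring map from the integers to [k]. *)
Definition freeg_ext (T : choiceType) (c : {freeg T / int}) : {freeg T / k} :=
  \sum_(x <- dom c) << (coeff x c)%:~R *g x >>.

Lemma coeff_freeg_ext (T : choiceType) (c : {freeg T / int}) y :
  coeff y (freeg_ext c) = (coeff y c)%:~R.
Proof.
rewrite /freeg_ext raddf_sum /=; under eq_bigr do rewrite coeffU.
have [yc|yc] := boolP (y \in dom c).
  rewrite (bigD1_seq y) ?uniq_dom //= eqxx mulr1 big1 ?addr0 // => x /negbTE ->.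
  by rewrite mulr0.
rewrite (coeff_outdom yc) big_seq big1 // => x xc.
by rewrite (_ : x == y = false) ?mulr0 //; apply: contraNF yc => /eqP <-.
Qed.

Lemma freeg_ext_zmod (T : choiceType) : zmod_morphism (@freeg_ext T).
Proof.
move=> a b; apply/eqP/freeg_eqP => y.
by rewrite coeff_freeg_ext !raddfB /= !coeff_freeg_ext.
Qed.
HB.instance Definition _ T := GRing.isZmodMorphism.Build _ _ (@freeg_ext T) (@freeg_ext_zmod T).

Lemma freeg_extZ (T : choiceType) (a : int) (c : {freeg T / int}) :
  freeg_ext (a *: c) = a%:~R *: freeg_ext c.
Proof.
by apply/eqP/freeg_eqP => y; rewrite coeff_freeg_ext !coeffZ coeff_freeg_ext intrM.
Qed.

Lemma freeg_extU (T : choiceType) (x : T) : freeg_ext << x >> = << x >>.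
Proof.
by apply/eqP/freeg_eqP => y; rewrite coeff_freeg_ext !coeffU !mul1r; case: eqP.
Qed.

(** Covers both boundaries and push-forwards of chains, which have integral values on simplices. *)
Lemma freeg_ext_lift (T U : choiceType) (f : T -> {freeg U / int}) (g : T -> {freeg U / k}) c :
  (forall s, freeg_ext (f s) = g s) -> freeg_ext (fglift f c) = fglift g (freeg_ext c).
Proof.
move=> fg; rewrite -[c]freeg_sumE (linear_sum (fglift f)) (raddf_sum (@freeg_ext U)).
rewrite (raddf_sum (@freeg_ext T)) linear_sum /=; apply: eq_bigr => s _.
have -> : << coeff s c *g s >> = coeff s c *: << s >>.
  by apply/eqP/freeg_eqP => y; rewrite coeffZ !coeffU mul1r.
rewrite freeg_extZ !linearZ /= freeg_extZ freeg_extU !liftU.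
by rewrite !scale1r fg.
Qed.

End FreegExtension.

Lemma common_denominator (I : finType) (q : I -> rat) :
  exists2 d : int, d != 0 & exists b : I -> int, forall i, q i * d%:~R = (b i)%:~R.
Proof.
exists (\prod_i denq (q i)).
  by apply/prodf_neq0 => i _; exact: denq_neq0.
exists (fun i => numq (q i) * \prod_(j | j != i) denq (q j)) => i.
by rewrite (bigD1 i) //= !intrM mulrA -numqE.
Qed.

(* The linear system expressing that the coefficients form a cycle has integer entries, so
   over F its solutions are spanned by the rational ones. *)
Lemma freeg_ker_span (F : fieldType) (iota : {rmorphism rat -> F}) (T U : choiceType)
  (f : T -> {freeg U / int}) (g : T -> {freeg U / F}) (c : {freeg T / F}) :
  (forall s, freeg_ext F (f s) = g s) -> fglift g c = 0 ->
  exists m (y : 'I_m -> F) (z : 'I_m -> {freeg T / int}),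
    (forall l, fglift f (z l) = 0) /\ c = \sum_l y l *: freeg_ext F (z l).
Proof.
move=> fg gc0.
pose n := size (dom c); pose t (i : 'I_n) := tnth (in_tuple (dom c)) i.
have cE : c = \sum_i coeff (t i) c *: << t i >>.
  rewrite -[LHS]freeg_sumE big_tnth; apply: eq_bigr => i _.
  by apply/eqP/freeg_eqP => y; rewrite coeffZ !coeffU mul1r.
(* All elements of [U] where some [f (t i)] is nonzero; repetitions only duplicate columns of
   [A]. *)
pose us := flatten [seq dom (f x) | x <- dom c].
pose u (j : 'I_(size us)) := tnth (in_tuple us) j.
pose A : 'M[rat]_(n, size us) := \matrix_(i, j) (coeff (u j) (f (t i)))%:~R.
pose x : 'rV[F]_n := \row_i coeff (t i) c.
(* Kernels of matrices commute with the field extension [iota], so [x] is a combination of rows of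
   the rational kernel. *)
have : (x <= map_mx iota (kermx A))%MS.
  rewrite map_kermx; apply/sub_kermxP/rowP => j; rewrite !mxE.
  transitivity (coeff (u j) (fglift g c)); last by rewrite gc0 coeff0.
  rewrite [in RHS]cE linear_sum raddf_sum; apply: eq_bigr => i _ /=.
  by rewrite !mxE rmorph_int linearZ /= coeffZ liftU scale1r -fg coeff_freeg_ext.
move=> /submxP[w wE].
(* Multiplying the rows of the kernel by [d] makes them integral; the weights [w ord0 l / d]
   compensate. *)
have [d d0 [b bE]] := common_denominator (fun li : 'I_n * 'I_n => kermx A li.1 li.2).
have dF : (d%:~R : F) != 0 by rewrite -(rmorph_int iota) fmorph_eq0 intr_eq0.
exists n, (fun l => w ord0 l / d%:~R), (fun l => \sum_i b (l, i) *: << t i >>); split.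
  move=> l; apply/eqP/freeg_eqP => y; rewrite coeff0 linear_sum raddf_sum /=.
  under eq_bigr do rewrite linearZ /= coeffZ liftU scale1r.
  have [yus|yus] := boolP (y \in us); last first.
    rewrite big1 // => i _; rewrite coeff_outdom ?mulr0 //.
    apply: contra yus => yi; apply/flatten_mapP; exists (t i) => //; exact: mem_tnth.
  have /tnthP[j yj] : y \in in_tuple us by [].
  apply: (@intr_inj rat); rewrite rmorph_sum /=.
  have /matrixP/(_ l j) : kermx A *m A = 0 by exact: mulmx_ker.
  rewrite !mxE => /(congr1 (fun q => q * d%:~R)); rewrite mul0r mulr_suml.
  move=> E; rewrite mulr0z -[RHS]E; apply: eq_bigr => i _.
  by rewrite intrM -bE !mxE /u yj mulrAC.
rewrite [LHS]cE.
under [RHS]eq_bigr => l _ do rewrite (raddf_sum (@freeg_ext F T)) scaler_sumr.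
rewrite exchange_big /=; apply: eq_bigr => i _.
under eq_bigr => l _ do rewrite freeg_extZ freeg_extU scalerA.
rewrite -scaler_suml; congr (_ *: _).
have /matrixP/(_ ord0 i) := wE; rewrite !mxE => ->; apply: eq_bigr => l _.
rewrite mxE -mulrA; congr (_ * _).
have := bE (l, i) => /(congr1 iota); rewrite rmorphM !rmorph_int /= => <-.
by rewrite [RHS]mulrC mulfK.
Qed.

(** * From integral classes to classes over [F] *)

Section CoefficientExtension.
Variables (R : realType) (F : fieldType).

Lemma boundary_face_ext (X : topologicalType) n (s : continuousType (simplex R n.+1) X) :
  freeg_ext F (\sum_(i < n.+2)
    (-1) ^+ i *: << (s \o face_map i : continuousType (simplex R n) X) >>) =
  \sum_(i < n.+2) (-1) ^+ i *: << (s \o face_map i : continuousType (simplex R n) X) >>.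
Proof.
rewrite (raddf_sum (@freeg_ext F _)); apply: eq_bigr => i _ /=.
by rewrite freeg_extZ freeg_extU rmorphXn rmorphN1.
Qed.

Lemma boundary_ext (X : topologicalType) n (c : chain R int X n.+1) :
  freeg_ext F (boundary c) = boundary (freeg_ext F c : chain R F X n.+1).
Proof. by apply: freeg_ext_lift; exact: boundary_face_ext. Qed.

Lemma push_chain_ext (X Y : topologicalType) (f : continuousType X Y) n (c : chain R int X n) :
  freeg_ext F (push_chain f c) = push_chain f (freeg_ext F c : chain R F X n).
Proof. by apply: freeg_ext_lift => s; exact: freeg_extU. Qed.

Section Classes.
Variable X : topologicalType.

Lemma cycle_ext_subproof (z : cycle1 R int X) :
  (freeg_ext F (val z) : chain R F X 1) \in @is_cycle R F X.
Proof.
rewrite unfold_in /is_cycle -boundary_ext; have /eqP -> := valP z.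
by rewrite (raddf0 (@freeg_ext F _)).
Qed.

Definition cycle_ext (z : cycle1 R int X) : cycle1 R F X := SigSub (cycle_ext_subproof z).

(** Defined on cycles; by additivity and [class_ext_eq0] its value depends only on the integral
    homology class. *)
Definition class_ext (z : cycle1 R int X) : H1 R F X := \pi_(H1 R F X) (cycle_ext z).

Lemma class_ext_zmod : zmod_morphism class_ext.
Proof.
move=> a b; rewrite /class_ext -raddfB; congr (\pi_(H1 R F X) _).
by apply: val_inj; rewrite /= !raddfB.
Qed.
HB.instance Definition _ := GRing.isZmodMorphism.Build _ _ class_ext class_ext_zmod.

Lemma class_ext_eq0 z : \pi_(H1 R int X) z = 0 -> class_ext z = 0.
Proof.
move=> z0; have : z \in @is_boundary R int X.
  by rewrite -[z]subr0 Quotient.idealrBE z0 raddf0.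
move=> /is_boundaryP[d hd]; apply/eqP; rewrite /class_ext -(raddf0 (\pi_(H1 R F X))).
rewrite -Quotient.idealrBE subr0; apply/is_boundaryP.
by exists (freeg_ext F d); rewrite -boundary_ext hd.
Qed.

(** The relation holds between cycles up to an integral boundary, which [class_ext] kills. It gives
    both the spanning property and the stability of L. *)
Lemma class_ext_generators n (g : 'I_n -> H1 R int X) (c : 'I_n -> int) z :
  \pi_(H1 R int X) z = \sum_i g i *~ c i ->
  class_ext z = \sum_i (c i)%:~R *: class_ext (repr (g i)).
Proof.
move=> zE; apply/eqP; rewrite -subr_eq0; apply/eqP.
have -> : \sum_i (c i)%:~R *: class_ext (repr (g i)) = class_ext (\sum_i repr (g i) *~ c i).
  by rewrite raddf_sum; apply: eq_bigr => i _; rewrite raddfMz scaler_int.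
rewrite -raddfB; apply: class_ext_eq0; rewrite raddfB /= zE raddf_sum.
by apply/eqP; rewrite subr_eq0; apply/eqP/eq_bigr => i _; rewrite raddfMz /= reprK.
Qed.

Lemma class_ext_span (iota : {rmorphism rat -> F}) (h : H1 R F X) :
  exists m (y : 'I_m -> F) (z : 'I_m -> cycle1 R int X), h = \sum_l y l *: class_ext (z l).
Proof.
have /eqP bz := valP (repr h).
(* The boundary is the linear extension of the integral face formula, so its kernel is spanned by
   integral cycles. *)
have [m [y [z [z0 hE]]]] := freeg_ker_span iota (@boundary_face_ext X 0) bz.
have cz l : (z l : chain R int X 1) \in @is_cycle R int X.
  by rewrite unfold_in; apply/eqP; exact: z0.
exists m, y, (fun l => SigSub (cz l)).
have -> : \sum_l y l *: class_ext (SigSub (cz l)) =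
    \pi_(H1 R F X) (\sum_l y l *: cycle_ext (SigSub (cz l))).
  by rewrite raddf_sum; apply: eq_bigr => l _ /=; rewrite pi_H1_scale.
rewrite -[LHS]reprK; congr (\pi_(H1 R F X) _); apply: val_inj.
by rewrite hE [RHS]raddf_sum; apply: eq_bigr.
Qed.

Lemma H1_map_class_ext (f : continuousType X X) z :
  H1_map f (class_ext z) = class_ext (push_cycle f z).
Proof.
rewrite pi_H1_map; congr (\pi_(H1 R F X) _); apply: val_inj => /=.
by rewrite push_chain_ext.
Qed.

Lemma class_ext_finite_span (iota : {rmorphism rat -> F}) n (g : 'I_n -> H1 R int X) :
  (forall x, exists c : 'I_n -> int, x = \sum_(i < n) g i *~ c i) ->
  forall h : H1 R F X, exists x, h = \sum_i x i *: class_ext (repr (g i)).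
Proof.
move=> gen h; have [m [y [z ->]]] := class_ext_span iota h.
have /choice[c hc] := fun l => gen (\pi_(H1 R int X) (z l)).
exists (fun i => \sum_l y l * (c l i)%:~R).
under [RHS]eq_bigr => i _ do rewrite scaler_suml.
rewrite exchange_big; apply: eq_bigr => l _ /=.
rewrite (class_ext_generators (hc l)) scaler_sumr.
by apply: eq_bigr => i _; rewrite scalerA.
Qed.

End Classes.
End CoefficientExtension.

Theorem corollary3 (R : realType) (K : set (sphere R 3)) (hK : is_knot K)
    (X : infinite_cyclic_cover K)
    (hfg : finitely_generated (H1 R int X))
    (p : nat) (hp : prime p)
    (N : vnorm R (H1 R (padic hp) X))
    (mu : {measure set (borel_type (normed_space N)) -> \bar R})
    (hmu : haar_measure mu) :
  has_entropy (0%R : normed_space N) mu (H1_map (deck X)) 0%E.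
Proof.
have [n [g gen]] := hfg.
pose v i := class_ext (padic hp) (repr (g i)).
apply: (@lattice_entropy _ _ _ _ _ _ v _ (H1_map (deck X))) hmu.
  exact: (class_ext_finite_span (@padic_rat p hp)).
(* The pushed-forward generator is an integral combination of generators, and integers are p-adic
   integers. *)
move=> i; have [c hc] := gen (\pi_(H1 R int X) (push_cycle (deck X) (repr (g i)))).
exists (fun j => (c j)%:~R); first by move=> j; exact: padic_intr.
by rewrite /v /= H1_map_class_ext (class_ext_generators _ hc).
Qed.
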